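(* Let $n$ and $m$ be integers with $n \geq m \geq 2$, and let $s = nm - m + \left\lceil \frac{m-4}{3} \right\rceil$. Then $F(P_n \boxtimes P_m) \geq s$, and there exists a set $S$ of $s$ vertices of $P_n \boxtimes P_m$ that is a maximal failed zero forcing set.
   Context: All graphs are simple, finite and undirected; $P_k$ is the path on $k$ vertices. The strong product $G \boxtimes H$ has vertex set $V(G)\times V(H)$, with $(u,v)$ adjacent to $(u',v')$ iff ($uu'\in E(G)$ and $vv'\in E(H)$), or ($u=u'$ and $vv'\in E(H)$), or ($v=v'$ and $uu'\in E(G)$). Zero forcing: each vertex is blue or white; starting from an initial set $S$ of blue vertices, repeatedly apply the color-change rule: if a blue vertex $u$ has exactly one white neighbor $v$, color $v$ blue. $S$ is a zero forcing set if eventually all vertices are blue, and a failed zero forcing set otherwise. $F(G)$ denotes the maximum cardinality of a failed zero forcing set of $G$. A failed zero forcing set $S$ is maximal if every set of vertices properly containing $S$ is a zero forcing set. *)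

(* Defs.v *)
From mathcomp Require Import all_boot all_order all_algebra.

Set Implicit Arguments.
Unset Strict Implicit.
Unset Printing Implicit Defensive.

(* A simple graph on a finite type is given by its adjacency relation,
   assumed symmetric and irreflexive. *)

Definition path_adj (n : nat) : rel 'I_n :=
  fun i j => (i.+1 == j :> nat) || (j.+1 == i :> nat).

Definition strong_adj (T U : finType) (e : rel T) (f : rel U) : rel (T * U) :=
  fun x y => [|| e x.1 y.1 && f x.2 y.2,
                 (x.1 == y.1) && f x.2 y.2
               | (x.2 == y.2) && e x.1 y.1].

Lemma path_adj_sym n : symmetric (@path_adj n).
Proof. by move=> i j; rewrite /path_adj orbC. Qed.

Lemma path_adj_irr n : irreflexive (@path_adj n).
Proof. by move=> i; rewrite /path_adj orbb; apply/negbTE; rewrite neq_ltn ltnSn orbT. Qed.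

Lemma strong_adj_sym (T U : finType) (e : rel T) (f : rel U) :
  symmetric e -> symmetric f -> symmetric (strong_adj e f).
Proof.
move=> es fs x y; rewrite /strong_adj (es y.1) (fs y.2).
by rewrite (eq_sym y.1) (eq_sym y.2).
Qed.

Lemma strong_adj_irr (T U : finType) (e : rel T) (f : rel U) :
  irreflexive e -> irreflexive f -> irreflexive (strong_adj e f).
Proof. by move=> ei fi x; rewrite /strong_adj ei fi !andbF. Qed.

Section ZeroForcing.
Variables (V : finType) (adj : rel V).
Implicit Types B S : {set V}.

Definition white_neighbors B (u : V) : {set V} :=
  [set v | adj u v & v \notin B].

(* One application of the color-change rule: B' is the blue set obtained from
   B when some u in B forces its only white neighbor v. *)
Definition color_change : rel {set V} :=
  fun B B' => [exists u in B, exists v,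
    (white_neighbors B u == [set v]) && (B' == v |: B)].

(* Some sequence of color changes leads from S to the all-blue coloring. *)
Definition zero_forcing S : bool := connect color_change S [set: V].

Definition failed S : bool := ~~ zero_forcing S.

Definition failed_number : nat := \max_(S : {set V} | failed S) #|S|.

Definition maximal_failed S : Prop :=
  failed S /\ forall S', S \proper S' -> zero_forcing S'.

End ZeroForcing.

(* Main.v *)
Require Import Defs.
From mathcomp Require Import all_boot all_order all_algebra.
From mathcomp Require Import zify lra.

Import GRing.Theory Num.Theory.

(** The white set lies in the first copy of [P_m], where it has pattern
    [110110...], the last two vertices being white as well.  A blue set is failed
    exactly when its complement contains a nonempty fort (a set meeting no outside
    vertex's neighborhood in exactly one point), so it is enough that this set is a
    minimal fort.  Every vertex of the second copy of [P_m] sees a window of at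
    most three consecutive vertices of the first; reading these windows from left
    to right shows that a nonempty fort inside the pattern starts with [11] and
    then has to contain the whole pattern. *)

Section Stalled.
Context {V : finType} (adj : rel V).

(** No force is possible from [B]: its complement is a fort or empty. *)
Definition stalled (B : {set V}) :=
  forall u v, u \in B -> white_neighbors adj B u != [set v].

Lemma stalled_failed {B : {set V}} : stalled B -> B != setT -> failed adj B.
Proof.
move=> stB neB; apply/negP => /connectP[[|B' p] /= pth lastB].
  by rewrite lastB eqxx in neB.
case/andP: pth => /existsP[u /andP[uB /existsP[v /andP[wu _]]]] _.
by move: (stB u v uB); rewrite wu.
Qed.

Lemma color_change_connect_sub {S B : {set V}} :
  connect (color_change adj) S B -> S \subset B.
Proof.
move=> /connectP[p + ->]; elim: p S => //= B' p IHp S /andP[+ pth].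
move=> /existsP[u /andP[_ /existsP[v /andP[_ /eqP eB']]]].
by apply: subset_trans (IHp _ pth); rewrite eB' subsetUr.
Qed.

(** A largest set reachable from [S] is stalled, since any further force would reach a larger
    one. *)
Lemma failed_sub_stalled {S : {set V}} :
  failed adj S -> exists B : {set V}, [/\ S \subset B, B != setT & stalled B].
Proof.
move=> fS.
have := @arg_maxnP _ S (connect (color_change adj) S) (fun B => #|B|) (connect0 _ S).
case=> B cB maxB.
exists B; split; first exact: color_change_connect_sub.
  by apply: contraNneq fS => eB; rewrite /zero_forcing -eB.
move=> u v uB; apply/negP => /eqP wu.
have : v \in white_neighbors adj B u by rewrite wu set11.
rewrite inE => /andP[_ vB].
have /maxB : connect (color_change adj) S (v |: B).
  apply: connect_trans cB (connect1 _).
  by apply/existsP; exists u; rewrite uB; apply/existsP; exists v; rewrite wu !eqxx.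
by rewrite cardsU1 vB; lia.
Qed.

End Stalled.

(** Equal or adjacent in the path; in these terms, strong adjacency is coordinatewise nearness of
    distinct vertices. *)
Definition near (j k : nat) : bool := (j <= k.+1) && (k <= j.+1).

Lemma strong_path_adjE (n m : nat) (u v : 'I_n * 'I_m) :
  strong_adj (@path_adj n) (@path_adj m) u v =
  [&& near u.1 v.1, near u.2 v.2 & u != v].
Proof.
case: u v => [i j] [i' j']; rewrite /strong_adj /path_adj /near /= xpair_eqE.
by rewrite -!val_eqE /=; lia.
Qed.

(* No window [j-1, j+1] of the row contains exactly one point of [x]. *)
Definition row_fort (m : nat) (x : pred nat) :=
  forall j k, j < m -> k < m -> near j k -> x k ->
  exists k', [&& k' < m, k' != k, near j k' & x k'].

(** Without the second disjunct, the window at the right end would hold a single point unless [m] is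
    2 modulo 3. *)
Definition pattern (m j : nat) : bool := (j %% 3 != 2) || (m <= j.+2).

Lemma pattern_row_fort {m : nat} : 2 <= m -> row_fort m (pattern m).
Proof.
move=> m2 j k jm km jk pk.
suff : [|| (0 < j) && (j.-1 != k) && pattern m j.-1, (j != k) && pattern m j |
       (j.+1 < m) && (j.+1 != k) && pattern m j.+1].
  case/or3P => [/andP[/andP[j0 ?] ?]|/andP[? ?]|/andP[/andP[? ?] ?]];
    [exists j.-1|exists j|exists j.+1]; apply/and4P; split=> //; rewrite /near; lia.
by move: jk pk; rewrite /near /pattern; lia.
Qed.

Lemma pattern_minimal {m : nat} {x : pred nat} :
  row_fort m x -> (forall j, j < m -> x j -> pattern m j) ->
  (exists2 j, j < m & x j) -> forall j, j < m -> pattern m j -> x j.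
Proof.
move=> fx xp [j0 j0m xj0].
(* If the first point of [x] were [j.+1], the window around [j] would contain it alone. *)
have x0 : x 0.
  apply: contraT => x0.
  suff /(_ j0 j0m) : forall j, j < m -> ~~ x j by rewrite xj0.
  elim/ltn_ind => -[//|j] IH jm; apply/negP => xj.
  have [|k /and4P[km kj jk]] := fx j j.+1 (ltnW jm) jm _ xj; first by rewrite /near; lia.
  by apply/negP/IH => //; move: jk; rewrite /near; lia.
elim/ltn_ind => -[//|[|j]] IH jm pj.
  have [k /and4P[km k0 jk xk]] := fx 0 0 (ltnW jm) (ltnW jm) isT x0.
  by have <- : k = 1 by move: jk; rewrite /near; lia.
have nx k : k < m -> k %% 3 = 2 -> k.+2 < m -> ~ x k.
  by move=> km k2 k2m /(xp _ km); rewrite /pattern; lia.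
have [jend|jend] := eqVneq j.+3 m.
  have xj1 : x j.+1 by apply: IH; rewrite /pattern; lia.
  have [||k /and4P[km kj jk xk]] := fx j.+2 j.+1 jm _ _ xj1; rewrite ?/near; try lia.
  by have <- : k = j.+2 by move: jk; rewrite /near; lia.
(* In the first two cases the window around [j.+1] holds a known point of [x], a gap of the pattern
   and [j.+2], so [j.+2] must be in [x]. *)
have [j0mod|[j1mod|j2mod]] :
    j.+2 %% 3 = 0 \/ j.+2 %% 3 = 1 \/ j.+2 %% 3 = 2 by lia.
- have xj : x j by apply: IH; rewrite /pattern; lia.
  have [|||k /and4P[km kj jk xk]] := fx j.+1 j _ _ _ xj; rewrite ?/near; try lia.
  have [|<- //] : k = j.+1 \/ k = j.+2 by move: jk; rewrite /near; lia.
  by move=> ek; case: (nx k) => //; lia.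
- have xj1 : x j.+1 by apply: IH; rewrite /pattern; lia.
  have [|||k /and4P[km kj jk xk]] := fx j.+1 j.+1 _ _ _ xj1; rewrite ?/near; try lia.
  have [|<- //] : k = j \/ k = j.+2 by move: jk; rewrite /near; lia.
  by move=> ek; case: (nx k) => //; lia.
(* With residue 2, [j.+2] is in the pattern only as last but one. The window around it yields [j.+2]
   or the last vertex; in the latter case the end window yields [j.+2]. *)
- have jm4 : m = j.+4 by move: pj; rewrite /pattern; lia.
  have xj1 : x j.+1 by apply: IH; rewrite /pattern; lia.
  have [|||k /and4P[km kj jk xk]] := fx j.+2 j.+1 _ _ _ xj1; rewrite ?/near; try lia.
  have [<- //|ek] : k = j.+2 \/ k = j.+3 by move: jk; rewrite /near; lia.
  have [|l /and4P[lm lk kl xl]] := fx k k km km _ xk; first by rewrite /near; lia.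
  by have <- : l = j.+2 by move: kl; rewrite /near; lia.
Qed.

Lemma sum_mod3 (k : nat) : \sum_(j < k) (j %% 3 == 2) = k %/ 3.
Proof.
elim: k => [|k IHk]; first by rewrite big_ord0.
by rewrite big_ord_recr /= IHk; case: eqP; lia.
Qed.

(** The gaps are the positions of residue 2 among the first [m - 2]. *)
Lemma card_pattern {m : nat} : 2 <= m ->
  #|[set j : 'I_m | pattern m j]| = m - (m - 2) %/ 3.
Proof.
case: m => [|[|k]] // _; rewrite subn2 /=.
have := cardsC [set j : 'I_k.+2 | pattern k.+2 j]; rewrite card_ord.
suff -> : #|~: [set j : 'I_k.+2 | pattern k.+2 j]| = k %/ 3 by move=> eC; rewrite -[X in _ = X - _]eC addnK.
rewrite -sum1_card big_mkcond !big_ord_recr /= -sum_mod3.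
rewrite [X in _ + X]ifF; last by rewrite !inE /pattern /=; lia.
rewrite [X in _ + X + _]ifF; last by rewrite !inE /pattern /=; lia.
rewrite !addn0; apply: eq_bigr => j _.
by rewrite !inE /pattern /=; have := ltn_ord j; case: ifP; case: eqP; lia.
Qed.

(** For every integer [a], the ceiling of [a / 3] is the floor of [(a + 2) / 3]. Taking [a = m - 4]
    gives a natural quotient even when [m < 4]. *)
Lemma ceil_third {m : nat} : 2 <= m ->
  Num.ceil ((m%:Q - 4%:Q) / 3%:Q)%R = ((m - 2) %/ 3)%:Z%R.
Proof.
move=> m2; apply: ceil_def.
set q := (_ %/ _).
have qm : (q%:Q * 3 + 2 <= m%:Q)%R by rewrite -!pmulrn -natrM -natrD ler_nat /q; lia.
have mq : (m%:Q <= q%:Q * 3 + 4)%R by rewrite -!pmulrn -natrM -natrD ler_nat /q; lia.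
by rewrite rmorphB /=; apply/andP; split; lra.
Qed.

Section RowSet.
Context {n m : nat} (hn : 2 <= n) (hm : 2 <= m).
Let G := strong_adj (@path_adj n) (@path_adj m).

Definition row_set : {set 'I_n * 'I_m} :=
  [set v : 'I_n * 'I_m | ~~ ((val v.1 == 0) && pattern m v.2)].

Lemma card_row_set : #|row_set| = n * m - (m - (m - 2) %/ 3).
Proof.
rewrite -card_pattern //.
pose i0 : 'I_n := Ordinal (ltnW hn).
have <- : ~: setX [set i0] [set j : 'I_m | pattern m j] = row_set.
  by apply/setP => -[i j]; rewrite !inE /=; congr (~~ (_ && _)); rewrite -val_eqE.
by rewrite cardsCs setCK cardsX cards1 mul1n card_prod !card_ord.
Qed.

(** A white neighbor of [u] comes with a second one in the same copy of the path, by
    [pattern_row_fort]; it differs from [u] because [u] is blue. *)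
Lemma stalled_row_set : stalled G row_set.
Proof.
move=> u v uS; apply/negP => /eqP wu.
have : v \in white_neighbors G row_set u by rewrite wu set11.
rewrite inE /G strong_path_adjE !inE negbK => /andP[/and3P[uv1 uv2 uv] /andP[v0 pv]].
have [k /and4P[km kv uk pk]] :=
  pattern_row_fort hm _ _ (ltn_ord u.2) (ltn_ord v.2) uv2 pv.
have : (v.1, Ordinal km) \in white_neighbors G row_set u.
  rewrite inE /G strong_path_adjE !inE negbK /= v0 uv1 uk pk !andbT /=.
  apply: contraTneq uS => ->.
  by rewrite inE /= v0 pk.
by rewrite wu inE => /eqP ev; rewrite -ev eqxx in kv.
Qed.

Lemma maximal_failed_row_set : maximal_failed G row_set.
Proof.
pose i0 : 'I_n := Ordinal (ltnW hn); pose i1 : 'I_n := Ordinal hn.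
split.
  apply: stalled_failed stalled_row_set _.
  apply/eqP => /setP/(_ (i0, Ordinal (ltnW hm))).
  by rewrite !inE /pattern /=.
move=> S' /properP[sub [w wS' wS]]; apply: contraT => /failed_sub_stalled.
case=> B [S'B]; rewrite -subTset => /subsetPn[b _ bB] stB.
have sB v : v \notin B -> (val v.1 == 0) && pattern m v.2.
  by move=> vB; apply: contraR vB => vS; apply/(subsetP S'B)/(subsetP sub); rewrite inE.
(* The white vertices of [B] all lie in the copy at [i0]; [x] records their second coordinates. *)
pose x k := [exists j : 'I_m, (j == k :> nat) && ((i0, j) \notin B)].
have xE (v : 'I_n * 'I_m) : v \notin B -> x v.2.
  move=> vB; apply/existsP; exists v.2; rewrite eqxx /=.
  have /andP[/eqP v0 _] := sB _ vB.
  by rewrite (_ : (i0, v.2) = v) //; case: v v0 {vB} => i j /= i0E; congr pair; apply/val_inj.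
have fx : row_fort m x.
  move=> j k jm km jk /existsP[k' /andP[/eqP ek kB]].
  (* The copy at [i1] is entirely blue, and its vertex [j] sees the whole window around [j] in the
     copy at [i0]. *)
  have uB : (i1, Ordinal jm) \in B by apply: contraT => /sB.
  have kw : (i0, k') \in white_neighbors G B (i1, Ordinal jm).
    by rewrite inE kB /G strong_path_adjE xpair_eqE /= ek jk.
  have : ~~ (white_neighbors G B (i1, Ordinal jm) \subset [set (i0, k')]).
    apply: contra (stB _ (i0, k') uB) => sw.
    by rewrite eqEsubset sw sub1set.
  case/subsetPn => v; rewrite !inE /G strong_path_adjE => /andP[/and3P[_ jv _] vB] vk.
  exists v.2; rewrite ltn_ord jv (xE v vB) /= andbT.
  apply: contraNneq vk; rewrite -ek => /val_inj ev.
  have /andP[/eqP v0 _] := sB _ vB.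
  by apply/eqP; case: v v0 ev {vB jv} => i l /= iE ->; congr pair; apply/val_inj.
have xp j : j < m -> x j -> pattern m j.
  by move=> _ /existsP[l /andP[/eqP <- /sB /andP[]]].
have /andP[/eqP w0 pw] : (val w.1 == 0) && pattern m w.2.
  by move: wS; rewrite inE negbK.
(* Minimality makes [w] white in [B], although [w] lies in [S'] and hence in [B]. *)
have /existsP[l /andP[/eqP lw]] : x w.2.
  apply: pattern_minimal fx xp _ _ (ltn_ord _) pw.
  by exists b.2; [exact: ltn_ord | exact: xE].
rewrite (_ : (i0, l) = w) ?(subsetP S'B) //.
by case: w w0 lw {wS' wS pw} => i k /= iE lk; congr pair; apply/val_inj.
Qed.

End RowSet.

Theorem theorem3p10 (n m : nat) (hm : (2 <= m)%N) (hnm : (m <= n)%N) :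
  let G := strong_adj (@path_adj n) (@path_adj m) in
  let s : int := (n%:Z * m%:Z - m%:Z
                  + Num.ceil ((m%:Q - 4%:Q) / 3%:Q))%R in
  (s <= (failed_number G)%:Z)%R /\
  exists S : {set 'I_n * 'I_m}, #|S|%:Z%R = s /\ maximal_failed G S.
Proof.
move=> G s; have hn := leq_trans hm hnm.
have cS : #|@row_set n m|%:Z%R = s.
  rewrite card_row_set // /s ceil_third //.
  (* This bound makes the truncated subtraction agree with the integer one. *)
  by have : m <= n * m; [rewrite leq_pmull | ]; lia.
have maxS := maximal_failed_row_set hn hm.
split; last by exists (@row_set n m).
rewrite -cS lez_nat.
rewrite /failed_number; apply: leq_bigmax_cond.
exact: maxS.1.
Qed.
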